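(* Let $\mathbb{X}\subset\mathbb{R}^n$ be a Lebesgue-measurable compact set and let $f:\mathbb{R}^n\to\mathbb{R}$ be positive homogeneous with $f|_{\mathbb{X}}$ Lebesgue integrable. Then for every $\epsilon>0$ there exists a finite-depth HomoMLP $\mathcal{A}'$ with ReLU activations and width at most $2(n+4)$, representing a function $F_{\mathcal{A}'}:\mathbb{R}^n\to\mathbb{R}$, such that $\int_{\mathbb{X}}|f(x)-F_{\mathcal{A}'}(x)|\,dx<\epsilon$.
   Context: A function $g$ is positive homogeneous iff $g(\lambda x)=\lambda g(x)$ for all $x$ and all $\lambda>0$. A HomoMLP is a multilayer perceptron without bias terms whose activation functions are positive homogeneous, i.e. a function of the form $x\mapsto W_L\,\sigma(W_{L-1}\,\sigma(\cdots\sigma(W_1x)\cdots))$ with weight matrices $W_1,\dots,W_L$ and positive homogeneous activation $\sigma$ applied coordinatewise (here $\sigma=\mathrm{ReLU}$). Its width is the maximal number of rows among $W_1,\dots,W_{L-1}$. *)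

(* Defs.v *)
From HB Require Import structures.
From mathcomp Require Import all_boot all_order all_algebra.
From mathcomp Require Import all_classical all_reals all_analysis.
Set Implicit Arguments. Unset Strict Implicit. Unset Printing Implicit Defensive.
Import Order.TTheory GRing.Theory Num.Theory.
Import numFieldNormedType.Exports.
Local Open Scope ring_scope.
Local Open Scope classical_set_scope.

Fixpoint RnM (R : realType) (n : nat) : {d : measure_display & measurableType d} :=
  match n with
  | 0 => existT _ _ (unit : measurableType _)
  | m.+1 => existT _ _ ((measurableTypeR R * projT2 (RnM R m))%type : measurableType _)
  end.

Definition Rn (R : realType) (n : nat) := projT2 (RnM R n).

Fixpoint borel_leb (R : realType) (n : nat) : {measure set (Rn R n) -> \bar R} :=
  match n return {measure set (Rn R n) -> \bar R} with
  | 0 => (\d_tt : {measure set unit -> \bar R})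
  | m.+1 => ((@lebesgue_measure R \x^ borel_leb R m)%E : {measure set (measurableTypeR R * Rn R m)%type -> \bar R})
  end.

Definition leb (R : realType) (n : nat) := @completed_measure_extension _ _ _ (borel_leb R n).

Fixpoint vec (R : realType) (n : nat) : Rn R n -> 'cV[R]_n :=
  match n return Rn R n -> 'cV[R]_n with
  | 0 => fun _ => 0
  | m.+1 => fun p => (col_mx (p.1%:M : 'cV[R]_1) (vec p.2) : 'cV[R]_(m.+1))
  end.

(* Lebesgue measure on R^n: the completion of the product of n copies of the
   (Borel) Lebesgue measure on R, carried by the Caratheodory sigma-algebra. *)
Definition LebRn (R : realType) (n : nat) := caratheodory_type (borel_leb R n)^*%mu.

Definition vecL (R : realType) (n : nat) : LebRn R n -> 'cV[R]_n := @vec R n.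

Definition positive_homogeneous (R : realType) (n : nat) (f : 'cV[R]_n -> R) :=
  forall (x : 'cV[R]_n) (lam : R), 0 < lam -> f (lam *: x) = lam * f x.

Definition relu (R : realType) (m : nat) (v : 'cV[R]_m) : 'cV[R]_m :=
  map_mx (fun t => Num.max t 0) v.

Inductive homoMLP (R : realType) : nat -> Type :=
| HLast (m : nat) of 'M[R]_(1, m) : homoMLP R m
| HLayer (m k : nat) of 'M[R]_(k, m) & homoMLP R k : homoMLP R m.

Fixpoint mlp_eval (R : realType) (m : nat) (A : homoMLP R m) : 'cV[R]_m -> R :=
  match A in homoMLP _ m return 'cV[R]_m -> R with
  | HLast _ W => fun x => (W *m x) ord0 ord0
  | HLayer _ _ W B => fun x => mlp_eval B (relu (W *m x))
  end.

Fixpoint mlp_width (R : realType) (m : nat) (A : homoMLP R m) : nat :=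
  match A with
  | HLast _ _ => 0%N
  | HLayer _ k _ B => maxn k (mlp_width B)
  end.

(* Main.v *)
(** A bias-free ReLU network with three hidden layers of arbitrary width can be
    run in width 2(n+4): carry the input and four real registers along, each
    split into its positive and negative part, and evaluate the network one
    neuron at a time, with one accumulator per layer.

    It remains to approximate [f] by such wide networks.  Write
    [|x| = sum_i |x_i|].  Truncating to [|f| <= c |x|] and slicing by levels,
    [f] is approximated in L^1 by combinations of the functions [|x| 1_C(x)]
    for the cones [C = {f >= a |x|}].  Inner regularity of Lebesgue measure gives
    disjoint compact sets [K] in [C] and [L] outside [C], both avoiding [0], that
    exhaust [X] up to small measure; as [C] is a cone, no ray meets both.  A
    homogeneous Urysohn lemma then gives a three-layer network with values in
    [[0, |x|]], equal to [|x|] on [K] and to [0] on [L]. *)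
Require Import Defs.
From HB Require Import structures.
From mathcomp Require Import all_boot all_order all_algebra.
From mathcomp Require Import all_classical all_reals all_analysis.
From mathcomp Require Import measurable_realfun ring lra.
Import Order.TTheory GRing.Theory Num.Theory.
Import numFieldNormedType.Exports.
Local Open Scope ring_scope.
Local Open Scope classical_set_scope.

Lemma max0_sub {R : realType} (a : R) : Num.max a 0 - Num.max (- a) 0 = a.
Proof. by case: (leP a 0) => ?; case: (leP (- a) 0) => ?; lra. Qed.

Lemma max0_add {R : realType} (a : R) : Num.max a 0 + Num.max (- a) 0 = `|a|.
Proof. by case: (ger0P a) => ?; case: (leP a 0) => ?; case: (leP (- a) 0) => ?; lra. Qed.

(** * Functions computed by bias-free ReLU networks with [k] hidden layers *)

Section Deep.
Context {R : realType} {n : nat}.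
Implicit Types (f g : 'cV[R]_n -> R) (x : 'cV[R]_n).

(** A network is described here by its function, without any bound on width. [deep_cons] adds a
    single neuron to the last hidden layer, so induction visits neurons one at a time, which is the
    order in which the narrow simulation runs them. *)
Inductive deep : nat -> ('cV[R]_n -> R) -> Prop :=
| deep_lin (u : 'rV[R]_n) : deep 0 (fun x => (u *m x) ord0 ord0)
| deep_zero k : deep k.+1 (fun=> 0)
| deep_cons k (c : R) f g :
    deep k f -> deep k.+1 g -> deep k.+1 (fun x => g x + c * Num.max (f x) 0).

Lemma deep0P f : deep 0 f ->
  exists u : 'rV[R]_n, f = (fun x : 'cV[R]_n => (u *m x) ord0 ord0).
Proof.
suff H k g : deep k g -> k = 0%N ->
    exists u : 'rV[R]_n, g = (fun x : 'cV[R]_n => (u *m x) ord0 ord0).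
  by move=> /H; apply.
by case=> // u _; exists u.
Qed.

Lemma deepD k f g : deep k f -> deep k g -> deep k (fun x => f x + g x).
Proof.
move=> Hf Hg; elim: Hf g Hg => {k f}.
- move=> u g /deep0P[v ->].
  rewrite (_ : (fun x => _) = (fun x : 'cV[R]_n => ((u + v) *m x) ord0 ord0)).
    exact: deep_lin.
  by apply/funext => x; rewrite mulmxDl [RHS]mxE.
- move=> k g Hg.
  by rewrite (_ : (fun x => _) = g) //; apply/funext => x; rewrite add0r.
- move=> k c f h Hf _ _ IH g Hg.
  rewrite (_ : (fun x => _) = (fun x => (h x + g x) + c * Num.max (f x) 0)).
    by apply: deep_cons => //; apply: IH.
  by apply/funext => x; rewrite addrAC.
Qed.

Lemma deepZ k c f : deep k f -> deep k (fun x => c * f x).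
Proof.
elim => {k f}.
- move=> u; rewrite (_ : (fun x => _) = (fun x : 'cV[R]_n => ((c *: u) *m x) ord0 ord0)).
    exact: deep_lin.
  by apply/funext => x; rewrite -scalemxAl [RHS]mxE.
- move=> k; rewrite (_ : (fun x => _) = (fun=> 0)); first exact: deep_zero.
  by apply/funext => x; rewrite mulr0.
- move=> k a f g Hf _ Hg IH.
  rewrite (_ : (fun x => _) = (fun x => c * g x + (c * a) * Num.max (f x) 0)).
    exact: deep_cons.
  by apply/funext => x; rewrite mulrDr mulrA.
Qed.

Lemma deep_relu k f : deep k f -> deep k.+1 (fun x => Num.max (f x) 0).
Proof.
move=> Hf; rewrite (_ : (fun x => _) = (fun x => 0 + 1 * Num.max (f x) 0)).
  by apply: deep_cons => //; apply: deep_zero.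
by apply/funext => x; rewrite add0r mul1r.
Qed.

Lemma deepB k f g : deep k f -> deep k g -> deep k (fun x => f x - g x).
Proof.
move=> Hf Hg; rewrite (_ : (fun x => _) = (fun x => f x + (-1) * g x)).
  by apply: deepD => //; apply: deepZ.
by apply/funext => x; rewrite mulN1r.
Qed.

(** A value crosses a ReLU layer unchanged as the difference of its positive and negative parts. *)
Lemma deepS k f : deep k f -> deep k.+1 f.
Proof.
move=> Hf; rewrite (_ : f = (fun x => Num.max (f x) 0 - Num.max ((-1) * f x) 0)).
  by apply: deepB; apply: deep_relu => //; apply: deepZ.
by apply/funext => x; rewrite mulN1r max0_sub.
Qed.

Lemma deep_abs k f : deep k f -> deep k.+1 (fun x => `|f x|).
Proof.
move=> Hf.
rewrite (_ : (fun x => _) = (fun x => Num.max (f x) 0 + Num.max ((-1) * f x) 0)).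
  by apply: deepD; apply: deep_relu => //; apply: deepZ.
by apply/funext => x; rewrite mulN1r max0_add.
Qed.

Lemma deep_sum k (I : Type) (s : seq I) (F : I -> 'cV[R]_n -> R) :
  (forall i, deep k (F i)) -> deep k (fun x => \sum_(i <- s) F i x).
Proof.
move=> HF; elim: s => [|i s IH].
  (* [deep_zero] covers only positive depth, so the empty sum is presented as a linear form and
     lifted to depth [k]. *)
  rewrite (_ : (fun x => _) = (fun x : 'cV[R]_n => 0 * ((0 : 'rV_n) *m x) ord0 ord0)).
    by elim: k {HF} => [|k IH]; [apply/deepZ/deep_lin | apply: deepS].
  by apply/funext => x; rewrite big_nil mul0r.
rewrite (_ : (fun x => _) = (fun x => F i x + \sum_(j <- s) F j x)).
  exact: deepD.
by apply/funext => x; rewrite big_cons.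
Qed.

Lemma deep_coord i : deep 0 (fun x : 'cV[R]_n => x i ord0).
Proof.
rewrite (_ : (fun x => _) = (fun x : 'cV[R]_n => ((delta_mx ord0 i : 'rV_n) *m x) ord0 ord0)).
  exact: deep_lin.
by apply/funext => x; rewrite -rowE mxE.
Qed.

End Deep.

(** * Simulation of three hidden layers in width 2(n+4) *)

Section Simulation.
Context {R : realType} {n : nat}.

Let N := (n + 4)%N.

Definition signed_parts (s : 'cV[R]_N) : 'cV[R]_(N + N) := relu (col_mx s (- s)).

Definition narrow (G : 'cV[R]_N -> R) :=
  exists2 B : homoMLP R (N + N), (mlp_width B <= N + N)%N &
    forall s, mlp_eval B (signed_parts s) = G s.

(** Continuation-passing form: [phi] can be run before any narrow computation. Programs then compose
    as functions, and no concatenation of networks has to be defined. *)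
Definition program (phi : 'cV[R]_N -> 'cV[R]_N) :=
  forall G, narrow G -> narrow (G \o phi).

Lemma program_comp phi psi : program phi -> program psi -> program (psi \o phi).
Proof. by move=> Hphi Hpsi G HG; exact (Hphi _ (Hpsi _ HG)). Qed.

Lemma signed_partsE (s : 'cV[R]_N) : signed_parts s = col_mx (relu s) (relu (- s)).
Proof. by rewrite /signed_parts /relu map_col_mx. Qed.

Lemma relu_sub (s : 'cV[R]_N) : relu s - relu (- s) = s.
Proof. by apply/matrixP => i j; rewrite !mxE max0_sub. Qed.

(* Keeping both parts of [s] makes [s] and [relu s] simultaneously linear in the
   current layer. *)
Lemma program_step (L M : 'M[R]_N) : program (fun s => L *m s + M *m relu s).
Proof.
move=> G [B wB GB].
exists (HLayer (block_mx (L + M) (- L) (- (L + M)) L) B) => /=.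
  by rewrite geq_max leqnn.
move=> s; rewrite -GB; congr mlp_eval; congr relu.
rewrite signed_partsE.
have := relu_sub s; move: (relu s) (relu (- s)) => a b <-.
rewrite mul_block_col mulmxBr; congr col_mx.
  by rewrite mulmxDl mulNmx addrAC.
by rewrite mulNmx mulmxDl !opprD opprK addrAC.
Qed.

(** The input is kept because every first-layer neuron reads it again. Of the four registers, three
    serve as accumulators for the hidden layers and the last holds the output. *)
Definition state (x : 'cV[R]_n) (r : 'cV[R]_4) : 'cV[R]_N := col_mx x r.

Lemma program_linear (u : 'rV[R]_n) (j : 'I_4) : exists2 phi, program phi &
  forall x r, phi (state x r) = state x (r + (u *m x) ord0 ord0 *: delta_mx j ord0).
Proof.
exists (fun s => block_mx 1%:M 0 (delta_mx j ord0 *m u) 1%:M *m s + 0 *m relu s).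
  exact: program_step.
move=> x r; rewrite mul0mx addr0 mul_block_col !mul1mx mul0mx addr0 addrC.
congr (col_mx _ (_ + _)).
by rewrite -mulmxA [u *m x]mx11_scalar mul_mx_scalar !mxE eqxx mulr1n.
Qed.

(** This fires one neuron: its pre-activation has been collected in register [k], its weighted
    output goes to register [j], and clearing [k] readies it for the next neuron. *)
Lemma program_flush (c : R) (k j : 'I_4) : exists2 phi, program phi &
  forall x r, phi (state x r) = state x (r - r k ord0 *: delta_mx k ord0
    + (c * Num.max (r k ord0) 0) *: delta_mx j ord0).
Proof.
exists (fun s => block_mx 1%:M 0 0 (1%:M - delta_mx k k) *m s
     + block_mx 0 0 0 (c *: delta_mx j k) *m relu s); first exact: program_step.
move=> x r; rewrite {2}/state /relu map_col_mx !mul_block_col.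
rewrite !mul0mx mul1mx !addr0 !add0r add_col_mx addr0.
have dE (i : 'I_4) (v : 'cV[R]_4) : delta_mx i k *m v = v k ord0 *: delta_mx i ord0.
  apply/matrixP => a b; rewrite !mxE ord1 (bigD1 k) //= big1 => [|l lk].
    by rewrite !mxE !eqxx andbT addr0 mulrC.
  by rewrite !mxE (negbTE lk) andbF mul0r.
congr (col_mx _ _); rewrite mulmxBl mul1mx -scalemxAl !dE scalerA.
by rewrite !mxE.
Qed.

(* The registers below [k] are scratch space: zero on entry, zero on exit. *)
Lemma program_deep k (f : 'cV[R]_n -> R) (j : 'I_4) : deep k f -> (k <= j)%N ->
  exists2 phi, program phi &
  forall x (r : 'cV[R]_4), (forall i : 'I_4, (i < k)%N -> r i ord0 = 0) ->
    phi (state x r) = state x (r + f x *: delta_mx j ord0).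
Proof.
move=> H; elim: H j => {k f} [u j _|k j _|k c f g _ IHf _ IHg j kj].
- by have [phi ? H] := program_linear u j; exists phi.
- by exists id => // x r _; rewrite scale0r addr0.
have k4 : (k < 4)%N by apply: leq_trans kj _; apply: ltnW.
pose k' : 'I_4 := Ordinal k4.
(* The pre-activation [f] is built in register [k], which is scratch at depth [k.+1], then flushed
   into [j]; the remaining neurons [g] of the layer follow. *)
have [phi1 P1 E1] := IHf k' (leqnn k).
have [phi2 P2 E2] := program_flush c k' j.
have [phi3 P3 E3] := IHg j kj.
exists (phi3 \o (phi2 \o phi1)).
  by apply: program_comp => //; apply: program_comp.
move=> x r Hr /=; rewrite E1; last by move=> i ik; apply/Hr/ltnW.
have rk : r k' ord0 = 0 by apply: Hr.
rewrite E2 !mxE !eqxx rk add0r mulr1 addrK E3; last first.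
  move=> i ik; rewrite !mxE Hr // add0r.
  by rewrite (_ : (i == j) = false) ?mulr0 //;
    apply/negbTE/eqP => ij; move: ik kj; rewrite ij ltnNge => /negP.
congr state; rewrite -addrA -scalerDl; congr (_ + _ *: _); exact: addrC.
Qed.

(** The first layer loads the input with all registers zero, the program writes [F] into register 3
    using registers 0 to 2 as scratch, and the last layer subtracts the two signed parts of register
    3. *)
Lemma deep3_narrow F : deep 3 F -> exists A : homoMLP R n,
  (mlp_width A <= 2 * (n + 4))%N /\ mlp_eval A = F.
Proof.
move=> HF; have [phi P E] := program_deep 3 F ord_max HF isT.
have [|B wB EB] := P (fun s => s (rshift n (ord_max : 'I_4)) ord0).
  exists (HLast (row_mx (delta_mx ord0 (rshift n ord_max))
      (- delta_mx ord0 (rshift n ord_max)))) => //.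
  move=> s /=; rewrite signed_partsE mul_row_col mulNmx -mulmxBr relu_sub.
  by rewrite -rowE mxE.
exists (HLayer (col_mx (col_mx 1%:M 0) (- col_mx 1%:M 0)) B); split.
  by rewrite /= mul2n -addnn geq_max leqnn.
apply/funext => x /=; rewrite mul_col_mx mulNmx.
rewrite (_ : col_mx 1%:M 0 *m x = state x 0); last first.
  by rewrite mul_col_mx mul1mx mul0mx.
have := EB (state x 0); rewrite /signed_parts => ->.
rewrite /= E => [|i _]; last by rewrite mxE.
by rewrite /state col_mxEd !mxE !eqxx mulr1 add0r.
Qed.

End Simulation.

(** * A homogeneous Urysohn lemma for networks *)

Section Urysohn.
Context {R : realType} {n : nat}.
Implicit Types (x y : 'cV[R]_n) (K L : set 'cV[R]_n).

(** The l^1 norm is chosen because one hidden layer computes it exactly. *)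
Definition norm1 x : R := \sum_(i < n) `|x i ord0|.

Lemma norm1_ge0 x : 0 <= norm1 x. Proof. exact: sumr_ge0. Qed.

Lemma norm1_gt0 x : x <> 0 -> 0 < norm1 x.
Proof.
move=> x0; rewrite lt_neqAle norm1_ge0 andbT eq_sym psumr_eq0 //.
apply/negP => /allP H; apply: x0; apply/matrixP => i j; rewrite (ord1 j) mxE.
by apply/eqP; rewrite -normr_eq0; apply: H; rewrite mem_index_enum.
Qed.

Lemma norm1Z (c : R) x : norm1 (c *: x) = `|c| * norm1 x.
Proof. by rewrite /norm1 mulr_sumr; apply: eq_bigr => i _; rewrite mxE normrM. Qed.

Lemma norm10 : norm1 0 = 0.
Proof. by rewrite /norm1 big1 // => i _; rewrite mxE normr0. Qed.

Lemma deep_norm1 : deep 1 norm1.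
Proof. by apply: deep_sum => i; apply: deep_abs; exact: deep_coord. Qed.

Lemma deep_continuous k (f : 'cV[R]_n -> R) : deep k f -> continuous f.
Proof.
elim => {k f} [u|k|k c f g _ cf _ cg] x.
- rewrite (_ : (fun x => _) = (fun x : 'cV[R]_n => \sum_j u ord0 j * x j ord0)).
    move: x; apply: continuous_big => [|j _] x; first exact: add_continuous.
    apply: (@continuousM R _ (fun=> u ord0 j) (fun x : 'cV[R]_n => x j ord0));
      [exact: cst_continuous|exact: coord_continuous].
  by apply/funext => z; rewrite mxE.
- exact: cst_continuous.
- apply: (@continuousD R R _ g (fun x : 'cV[R]_n => c * Num.max (f x) 0)); first exact: cg.
  apply: (@continuousM R _ (fun=> c) (fun x : 'cV[R]_n => Num.max (f x) 0));
    first exact: cst_continuous.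
  by apply: continuous_max; [exact: cf|exact: cst_continuous].
Qed.

(** On [K] the function [a] attains a maximum and [b] a positive minimum; [M] is the quotient of the
    absolute value of the former by the latter. *)
Lemma compact_dominated K (a b : 'cV[R]_n -> R) : compact K ->
  continuous a -> continuous b -> (forall x, K x -> 0 < b x) ->
  exists2 M : R, 0 <= M & forall x, K x -> a x <= M * b x.
Proof.
move=> cK ca cb b0.
have [->|/set0P K0] := eqVneq K set0; first by exists 0.
have [c _ Hc] := compact_EVT_max K0 cK (continuous_subspaceT ca).
have [d /set_mem Kd Hd] := compact_EVT_min K0 cK (continuous_subspaceT cb).
have bd := b0 _ Kd.
exists (`|a c| / b d); first by rewrite divr_ge0 // ltW.
move=> x Kx; apply: (le_trans (Hc _ (mem_set Kx))).
rewrite mulrAC ler_pdivlMr //; apply: le_trans (ler_wpM2l (normr_ge0 _) (Hd _ (mem_set Kx))).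
by apply: ler_wpM2r; [exact: ltW|exact: ler_norm].
Qed.

(** The case of a single ray; compactness of [K] later reduces the Urysohn lemma to it. *)
Lemma deep_separate_point L y : compact L -> ~ L 0 -> y <> 0 ->
  (forall lam, 0 < lam -> ~ L (lam *: y)) ->
  exists h, [/\ deep 2 h, forall x, 0 <= h x, 0 < h y & forall x, L x -> h x = 0].
Proof.
move=> cL L0 y0 HL.
have /existsP[i yi] : [exists i, y i ord0 != 0].
  apply: contrapT => /negP; rewrite negb_exists => /forallP H; apply: y0.
  by apply/matrixP => i j; rewrite (ord1 j) mxE; apply/eqP; rewrite -[_ == _]negbK.
(* [l y = 1], and [q x = 0] exactly when [x = l x *: y] with [0 <= l x]; hence
   [l - M * q] is nonpositive on [L] for large [M] but equals [1] at [y]. *)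
pose l x := (y i ord0)^-1 * x i ord0.
have dl : deep 0 l by apply: deepZ; exact: deep_coord.
pose q x := \sum_(j < n) `|x j ord0 - y j ord0 * l x| + Num.max (- 1 * l x) 0.
have dq : deep 1 q.
  apply: deepD; last by apply: deep_relu; apply: deepZ.
  apply: deep_sum => j; apply: deep_abs; apply: deepB; first exact: deep_coord.
  exact: deepZ.
have qE x : q x = norm1 (x - l x *: y) + Num.max (- 1 * l x) 0.
  by congr (_ + _); apply: eq_bigr => j _; rewrite !mxE [l x * _]mulrC.
(* [L] misses the whole closed ray through [y]: the origin by [L0], the open ray by [HL]. *)
have q0 x : L x -> 0 < q x.
  move=> Lx; rewrite qE; have [lx|lx] := ltP (l x) 0.
    by rewrite ltr_wpDl ?norm1_ge0 // lt_max mulN1r oppr_gt0 lx.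
  rewrite ltr_pwDl ?le_max ?lexx ?orbT //; apply: norm1_gt0 => /subr0_eq xE.
  move: lx; rewrite le_eqVlt => /orP[/eqP lx0|lx].
    by apply: L0; rewrite -(scale0r y) lx0 -xE.
  by apply: (HL _ lx); rewrite -xE.
have [M M0 HM] := compact_dominated L l q cL
  (deep_continuous _ _ dl) (deep_continuous _ _ dq) q0.
exists (fun x => Num.max (l x - M * q x) 0); split.
- by apply: deep_relu; apply: deepB; [exact: deepS|exact: deepZ].
- by move=> x; rewrite le_max lexx orbT.
- have ly : l y = 1 by rewrite /l mulVf.
  by rewrite qE ly scale1r subrr norm10 add0r (max_r (x := - 1 * 1)) ?mulr0 ?subr0
    ?lt_max ?ltr01 //; lra.
- by move=> x Lx; apply: max_r; rewrite subr_le0; exact: HM.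
Qed.

(** Finitely many sets where some [h y] is positive cover [K]. The sum [S] of these [h y] is
    positive on [K] and zero on [L], so for large [k] the minimum of [norm1] and [k * S] is as
    required. *)
Lemma deep_urysohn K L : compact K -> compact L -> ~ K 0 -> ~ L 0 ->
  (forall x lam, K x -> 0 < lam -> ~ L (lam *: x)) ->
  exists p, [/\ deep 3 p, forall x, 0 <= p x <= norm1 x,
    forall x, K x -> p x = norm1 x & forall x, L x -> p x = 0].
Proof.
move=> cK cL K0 L0 KL.
have /choice[h Hh] : forall y, exists h, [/\ deep 2 h, forall x, 0 <= h x &
    K y -> 0 < h y /\ forall x, L x -> h x = 0].
  (* Off [K] the zero function is a default that makes the choice total. *)
  move=> y; have [Ky|nKy] := pselect (K y); last first.
    by exists (fun=> 0); split => //; exact: deep_zero.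
  have [|h [dh h0 hy hL]] := deep_separate_point L y cL L0 _ (fun lam => KL y lam Ky).
    by move=> y0; apply: K0; rewrite -y0.
  by exists h.
have dh y : deep 2 (h y) by case: (Hh y).
have h0 y x : 0 <= h y x by case: (Hh y).
have := cK; rewrite compact_cover => /(_ _ K (fun y => [set x | 0 < h y x])).
case.
- move=> y Ky; apply: open_comp (@open_gt _ 0) => x _.
  exact: (deep_continuous _ _ (dh y)).
- by move=> y Ky; exists y => //; have [_ _ /(_ Ky)[]] := Hh y.
move=> T TK KT.
pose S x := \sum_(y <- finmap.enum_fset T) h y x.
have dS : deep 2 S by exact: deep_sum.
have S0 x : 0 <= S x by exact: sumr_ge0.
have SK x : K x -> 0 < S x.
  move=> /KT[y /= yT hyx]; rewrite /S (big_rem y) //=.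
  by rewrite ltr_pwDl // sumr_ge0.
have [k k0 Hk] := compact_dominated K norm1 S cK
  (deep_continuous _ _ deep_norm1) (deep_continuous _ _ dS) SK.
(* This is the minimum of [norm1 x] and [k * S x], written with one ReLU. *)
exists (fun x => norm1 x - Num.max (norm1 x - k * S x) 0); split.
- apply: deepB; first by do 2!apply: deepS; exact: deep_norm1.
  by apply: deep_relu; apply: deepB; [apply: deepS; exact: deep_norm1|exact: deepZ].
- move=> x; have := norm1_ge0 x; have : 0 <= k * S x by rewrite mulr_ge0.
  by case: (leP (norm1 x - k * S x) 0); lra.
- by move=> x Kx; rewrite max_r ?subr0 // subr_le0; exact: Hk.
- move=> x Lx; have -> : S x = 0.
    rewrite /S big_seq big1 // => y yT.
    by have [_ _ /(_ (set_mem (TK _ yT)))[_]] := Hh y; exact.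
  by rewrite mulr0 subr0 max_l ?norm1_ge0 // subrr.
Qed.

End Urysohn.

(** * Regularity of finite measures by the good-sets principle *)

Section Regularity.
Context {R : realType} {d} {T : measurableType d} (mu : {finite_measure set T -> \bar R}).
(* [cl] plays the role of the closed sets, so no topology on [T] is needed. *)
Variable cl : set (set T).
Hypothesis cl_measurable : forall A, cl A -> measurable A.
Hypothesis cl0 : cl set0.
Hypothesis clT : cl setT.
Hypothesis clU : forall A B, cl A -> cl B -> cl (A `|` B).
Hypothesis cl_bigcap : forall F : (set T)^nat, (forall k, cl (F k)) -> cl (\bigcap_k F k).

Definition regular_set (B : set T) := forall e : R, 0 < e ->
  exists F U, [/\ cl F, cl (~` U), F `<=` B, B `<=` U & (mu (U `\` F) < e%:E)%E].

Lemma regular_setC B : regular_set B -> regular_set (~` B).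
Proof.
move=> HB e e0; have [F [U [cF cU FB BU H]]] := HB _ e0.
exists (~` U), (~` F); rewrite setCK; split => //; try exact: subsetC.
by rewrite setDE setCK setIC -setDE.
Qed.

Let clC_measurable U : cl (~` U) -> measurable U.
Proof. by move=> /cl_measurable /measurableC; rewrite setCK. Qed.

(** The union of the outer sets is again admissible, but the union of the inner sets need not be. It
    is cut to a finite union, at small cost by continuity from above, which uses that [mu] is
    finite. *)
Lemma regular_set_bigcup (B : (set T)^nat) :
  (forall k, regular_set (B k)) -> regular_set (\bigcup_k B k).
Proof.
move=> HB e e0.
have /choice[FO HFO] : forall k, exists FO : set T * set T,
    [/\ cl FO.1, cl (~` FO.2), FO.1 `<=` B k, B k `<=` FO.2 &
      (mu (FO.2 `\` FO.1) < (e / 2 / (2 ^ k.+1)%N%:R)%:E)%E].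
  move=> k; have ek : 0 < e / 2 / (2 ^ k.+1)%N%:R by rewrite !divr_gt0 ?ltr0n ?expn_gt0.
  by have [F [U H]] := HB k _ ek; exists (F, U).
pose F k := (FO k).1; pose U k := (FO k).2.
have cF k : cl (F k) by case: (HFO k).
have cU k : cl (~` U k) by case: (HFO k).
have mF k : measurable (F k) by exact: cl_measurable.
have mU k : measurable (U k) by exact: clC_measurable.
have clFN N : cl (\big[setU/set0]_(k < N) F k).
  by elim: N => [|N IH]; rewrite ?big_ord0// big_ord_recr /=; apply: clU.
pose G N := (\bigcup_k U k) `\` \big[setU/set0]_(k < N) F k.
have mUO : measurable (\bigcup_k U k) by exact: bigcup_measurable.
have mG N : measurable (G N) by apply: measurableD => //; exact: cl_measurable.
have GE : \bigcap_N G N = (\bigcup_k U k) `\` (\bigcup_k F k).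
  apply/seteqP; split => [t Ht|t [Ot Ft] N _].
    split; first by case: (Ht 0%N I).
    move=> [k _ Fkt]; have [_] := Ht k.+1 I; apply.
    by rewrite -bigcup_mkord; exists k => /=.
  split=> //; rewrite -bigcup_mkord => -[k _ Fkt]; apply: Ft; by exists k.
(* The gaps sum to at most [e / 2] by the geometric weights; this leaves room for the strict bound
   at a finite stage [N]. *)
have lim_le : (mu (\bigcap_N G N) <= (e / 2)%:E)%E.
  rewrite GE; apply: (@le_trans _ _ (\sum_(k <oo) mu (U k `\` F k))%E).
    apply: measure_sigma_subadditive => //.
    - by move=> k; exact: measurableD.
    - by apply: measurableD => //; exact: bigcup_measurable.
    - move=> t [[k _ Okt] Ft]; exists k => //; split => // Fkt; apply: Ft; by exists k.
  apply: (@le_trans _ _ (\sum_(k <oo) (e / 2 / (2 ^ k.+1)%N%:R)%:E)%E).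
    apply: lee_nneseries => // k _; have [_ _ _ _ /ltW H] := HFO k; exact: H.
  by apply: epsilon_trick0; rewrite divr_ge0 // ltW.
have cvgG : mu \o G @ \oo --> mu (\bigcap_N G N).
  apply: nonincreasing_cvg_mu => //.
  - by rewrite ltey_eq fin_num_measure.
  - by apply: bigcap_measurable.
  - move=> m k mk; apply/subsetPset; apply: setDS.
    by rewrite -!bigcup_mkord; apply: bigcup_sub => i /= im;
      apply: bigcup_sup => /=; apply: leq_trans mk.
have lt_e : (mu (\bigcap_N G N) < e%:E)%E.
  by rewrite (le_lt_trans lim_le) // lte_fin ltr_pdivrMr // ltr_pMr // ltr1n.
have [N _ /(_ N (leqnn N)) GN] := cvgG _ (open_ereal_lt' lt_e).
exists (\big[setU/set0]_(k < N) F k), (\bigcup_k U k); split => //.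
- by rewrite setC_bigcup; apply: cl_bigcap.
- rewrite -bigcup_mkord => t [k _ Fkt]; exists k => //.
  by case: (HFO k) => _ _ + _ _; apply.
- by apply: subset_bigcup => k _; case: (HFO k).
Qed.

Lemma regular_sigma_algebra : sigma_algebra setT regular_set.
Proof.
split => [e e0|B /regular_setC|B]; last exact: regular_set_bigcup.
- exists set0, set0; rewrite setC0 set0D measure0 lte_fin; split => //.
- by rewrite setTD.
Qed.

End Regularity.

(** * Coordinates on iterated products and generation of the Borel sets *)

Section Coordinates.
Context {R : realType}.

Lemma vec0 n (p : Rn R n.+1) : vec p ord0 ord0 = p.1.
Proof.
by rewrite /= mxE; case: splitP => // j _; rewrite mxE (ord1 j).
Qed.

Lemma vecS n (p : Rn R n.+1) (i : 'I_n) : vec p (lift ord0 i) ord0 = vec p.2 i ord0.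
Proof.
rewrite /= mxE; case: splitP => [j|k [/val_inj ->]] //.
by rewrite (ord1 j).
Qed.

Lemma vec_surj n (x : 'cV[R]_n) : exists p : Rn R n, vec p = x.
Proof.
elim: n x => [|n IH] x; first by exists tt; apply/matrixP => -[].
have [q Hq] := IH (dsubmx (x : 'cV[R]_(1 + n))).
exists ((x ord0 ord0, q) : Rn R n.+1); apply/matrixP => i j; rewrite (ord1 j).
have [k ->|->] := unliftP ord0 i; last by rewrite vec0.
by rewrite vecS /= Hq mxE; congr (x _ _); exact: val_inj.
Qed.

Lemma measurable_vec n i : measurable_fun setT (fun p : Rn R n => vec p i ord0).
Proof.
elim: n i => [|n IH] i; first by case: i.
have [k ->|->] := unliftP ord0 i.
  rewrite (_ : (fun p => _) = (fun p : Rn R n => vec p k ord0) \o snd).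
    exact: measurableT_comp (IH k) measurable_snd.
  by apply/funext => p; rewrite vecS.
rewrite (_ : (fun p => _) = fst); first exact: measurable_fst.
by apply/funext => p; rewrite vec0.
Qed.

Lemma sigma_algebra_preimage {T U : Type} (h : T -> U) (G : set (set T)) :
  sigma_algebra setT G -> sigma_algebra setT [set B | G (h @^-1` B)].
Proof.
move=> [G0 GC GU]; split => /=; first by rewrite preimage_set0.
  by move=> A /GC; rewrite !setTD preimage_setC.
by move=> A HA; rewrite preimage_bigcup; exact: GU.
Qed.

(** Open coordinate half-spaces generate the product sigma-algebra. By induction on [n]: the product
    is generated by preimages under both projections, and the sets whose preimage lies in [G] form a
    sigma-algebra on each factor. *)
Lemma Rn_measurable_min n (G : set (set (Rn R n))) : sigma_algebra setT G ->
  (forall i c, G [set p | c < vec p i ord0]) -> measurable `<=` G.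
Proof.
elim: n G => [|n IH] G sG HG.
  case: sG => G0 GC _ A _.
  have [At|At] := pselect (A tt).
    rewrite (_ : A = setT); first by rewrite -(setD0 setT); exact: GC.
    by apply/seteqP; split => -[].
  by rewrite (_ : A = set0) //; apply/seteqP; split => -[].
suff H : preimage_set_system setT (@fst (measurableTypeR R) (Rn R n)) measurable
    `|` preimage_set_system setT (@snd (measurableTypeR R) (Rn R n)) measurable `<=` G.
  exact (smallest_sub sG H).
move=> A [[B mB]|[B mB]] <-; rewrite setTI.
- have sG' := sigma_algebra_preimage (@fst (measurableTypeR R) (Rn R n)) G sG.
  move: B mB; change (@measurable _ (measurableTypeR R) `<=` [set B | G (fst @^-1` B)]).
  rewrite RGenOInfty.measurableE; apply: smallest_sub => // _ [c ->] /=.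
  rewrite (_ : _ @^-1` _ = [set p : Rn R n.+1 | c < vec p ord0 ord0]) //.
  by apply/seteqP; split => p; rewrite /= vec0 in_itv /= andbT.
- have sG' := sigma_algebra_preimage (@snd (measurableTypeR R) (Rn R n)) G sG.
  move: B mB; apply: IH => // i c /=.
  rewrite (_ : _ @^-1` _ = [set p : Rn R n.+1 | c < vec p (lift ord0 i) ord0]) //.
  by apply/seteqP; split => p; rewrite /= vecS.
Qed.

Lemma box_finite n (M : R) : let B := [set p : Rn R n | forall i, `|vec p i ord0| <= M] in
  measurable B /\ (borel_leb R n B < +oo)%E.
Proof.
elim: n => [|n [mB fB]] B.
  rewrite (_ : B = setT); last by apply/seteqP; split => // p _ [].
  split; first exact: measurableT.
  by rewrite /= diracT ltry.
have BE : B = `[- M, M]%classic `*` [set p : Rn R n | forall i, `|vec p i ord0| <= M].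
  apply/seteqP; split => p.
    move=> Bp; split; first by have := Bp ord0; rewrite vec0 ler_norml /= in_itv.
    by move=> i; have := Bp (lift ord0 i); rewrite vecS.
  move=> [+ Hp] i; have [k ->|->] := unliftP ord0 i; first by rewrite vecS => _; exact: Hp.
  by rewrite vec0 ler_norml /= in_itv.
have mI : measurable (`[- M, M]%classic : set (measurableTypeR R)) by exact: measurable_itv.
rewrite BE; split; first exact: measurableX.
rewrite /= product_measure2E //.
have fI : (lebesgue_measure (`[(- M)%R, M]%classic : set R) < +oo)%E.
  by rewrite lebesgue_measure_itv /=; case: ifP => // _; rewrite -EFinB ltry.
apply: lte_mul_pinfty => //; by rewrite ge0_fin_numE.
Qed.

End Coordinates.

(** * Inner regularity of Lebesgue measure on compact sets *)

Section Lebesgue.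
Context {R : realType} {n : nat}.

Lemma measurable_borel (A : set (Rn R n)) : measurable A -> measurable (A : set (LebRn R n)).
Proof. by move=> mA; apply: sub_caratheodory; exact: sub_sigma_algebra. Qed.

Lemma measurable_vecL i : measurable_fun setT (fun p : LebRn R n => vecL p i ord0).
Proof.
move=> _ B mB; apply: measurable_borel.
exact: (@measurable_vec R n i measurableT B mB).
Qed.

Lemma leb_finite (X : set 'cV[R]_n) :
  measurable (@vecL R n @^-1` X) -> compact X -> (@leb R n (@vecL R n @^-1` X) < +oo)%E.
Proof.
move=> mX /compact_bounded [M [_ HM]].
(* Boundedness gives a norm bound only for radii strictly above [M], hence the box of half-side
   [|M| + 1]. *)
have [mB fB] := box_finite n (`|M| + 1).
apply: le_lt_trans fB.
rewrite -(@measurable_mu_extE _ _ _ (borel_leb R n)) //.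
apply: le_mu_ext => p Xp i.
have M1 : M < `|M| + 1 by rewrite (le_lt_trans (ler_norm _)) ?ltrDl.
apply: le_trans (HM _ M1 (vecL p) Xp).
rewrite [leRHS]/Num.norm /= mx_normrE; apply/bigmax_geP; right => /=.
by exists (i, ord0).
Qed.

(** Measurability is bundled with closedness so that the hypothesis [cl_measurable] holds
    outright. *)
Definition closed_preimage (A : set (LebRn R n)) :=
  measurable A /\ exists2 F, closed F & A = @vecL R n @^-1` F.

Variables (D : set (LebRn R n)) (mD : measurable D).
Hypothesis fD : (@leb R n D < +oo)%E.

Let nu : set (LebRn R n) -> \bar R := mrestr (@leb R n) mD.

Let fin_nu : fin_num_fun nu.
Proof.
apply: lty_fin_num_fun; apply: le_lt_trans fD.
by apply: le_measure; rewrite ?inE; [exact: measurableI|exact: mD|exact: subIsetr].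
Qed.

HB.instance Definition _ := Measure.on nu.
HB.instance Definition _ := @Measure_isFinite.Build _ _ _ nu fin_nu.

(** Regular sets form a sigma-algebra, so half-spaces suffice. An open half-space is exhausted by
    the closed ones at distance [1 / (k + 1)] inside it, and [nu] is finite. *)
Lemma borel_regular : @measurable _ (Rn R n) `<=` regular_set nu closed_preimage.
Proof.
apply: Rn_measurable_min.
  apply: regular_sigma_algebra => //=.
  - by move=> A [].
  - by split => //; exists set0; [exact: closed0|rewrite preimage_set0].
  - by split => //; exists setT; [exact: closedT|rewrite preimage_setT].
  - move=> A B [mA [F cF AE]] [mB [G cG BE]]; split; first exact: measurableU.
    by exists (F `|` G); [exact: closedU|rewrite AE BE preimage_setU].
  - move=> F HF; have /choice[G HG] : forall k, exists G, closed G /\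
      F k = @vecL R n @^-1` G.
      by move=> k; have [_ [G ? ?]] := HF k; exists G.
    split; first by apply: bigcapT_measurable => k; case: (HF k).
    exists (\bigcap_k G k); first by apply: closed_bigI => k _; case: (HG k).
    rewrite preimage_bigcap; apply: eq_bigcapr => k _; by case: (HG k).
move=> i c e e0.
pose F k := [set p : LebRn R n | c + k.+1%:R^-1 <= vecL p i ord0].
pose U := [set p : LebRn R n | c < vecL p i ord0].
have mF k : measurable (F k).
  rewrite (_ : F k = setT `&` (fun p => vecL p i ord0) @^-1` `[c + k.+1%:R^-1, +oo[); last first.
    by rewrite setTI; apply/seteqP; split => p; rewrite /F /= in_itv /= andbT.
  by apply: measurable_vecL => //; exact: measurable_itv.
have mU : measurable U.
  rewrite (_ : U = setT `&` (fun p => vecL p i ord0) @^-1` `]c, +oo[); last first.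
    by rewrite setTI; apply/seteqP; split => p; rewrite /U /= in_itv /= andbT.
  by apply: measurable_vecL => //; exact: measurable_itv.
have ccoord : continuous (fun x : 'cV[R]_n => x i ord0) by exact: coord_continuous.
have cF k : closed_preimage (F k).
  split => //; exists [set x : 'cV[R]_n | c + k.+1%:R^-1 <= x i ord0] => //.
  by apply: (preimage_closed _ (@closed_ge _ (c + k.+1%:R^-1))) => x _; exact: ccoord.
have cU : closed_preimage (~` U).
  split; first exact: measurableC.
  exists [set x : 'cV[R]_n | x i ord0 <= c].
    by apply: (preimage_closed _ (@closed_le _ c)) => x _; exact: ccoord.
  by apply/seteqP; split => p /=; rewrite /U /=;
    [move/negP; rewrite -leNgt|move=> H; apply/negP; rewrite -leNgt].
have cvg0 : nu \o (fun k => U `\` F k) @ \oo --> 0%E.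
  have -> : 0%E = nu (\bigcap_k (U `\` F k)).
    rewrite (_ : \bigcap_k _ = set0) ?measure0 //.
    apply/seteqP; split => // p Hp.
    have [Up _] : (U `\` F 0%N) p by exact: Hp.
    have d0 : 0 < vecL p i ord0 - c by rewrite subr_gt0.
    have [k] := ltr_add_invr Up.
    by move=> /ltW H; have [_] := Hp k I; apply.
  apply: nonincreasing_cvg_mu => //.
  - by rewrite ltey_eq fin_num_measure //; exact: measurableD.
  - by move=> k; exact: measurableD.
  - by apply: bigcapT_measurable => k; exact: measurableD.
  - move=> m k mk; apply/subsetPset; apply: setDS => p; rewrite /F /=.
    by apply: le_trans; rewrite lerD2l lef_pV2 ?posrE // ler_nat ltnS.
have e0' : (0 < e%:E)%E by rewrite lte_fin.
have [k _ /(_ k (leqnn k)) Hk] := cvg0 _ (open_ereal_lt' e0').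
exists (F k), U; split => //.
by move=> p; rewrite /F /=; apply: lt_le_trans; rewrite ltrDl invr_gt0.
Qed.

(** [E] is only Lebesgue measurable, so [D \ E] is first enclosed in a Borel set [A] with excess
    below [e / 2]. Regularity applied to the complement of [A] gives a closed set, whose trace on
    [X] is compact and lies in [E]. *)
Lemma inner_compact (X : set 'cV[R]_n) (E : set (LebRn R n)) (e : R) :
  D = @vecL R n @^-1` X -> compact X ->
  measurable E -> E `<=` D -> 0 < e ->
  exists K, [/\ compact K, K `<=` X, measurable (@vecL R n @^-1` K),
    @vecL R n @^-1` K `<=` E & (@leb R n (E `\` @vecL R n @^-1` K) < e%:E)%E].
Proof.
move=> DX cX mE ED e0.
have e20 : 0 < e / 2 by rewrite divr_gt0.
have mDE : measurable (D `\` E) by exact: measurableD.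
have fDE : @leb R n (D `\` E) \is a fin_num.
  rewrite ge0_fin_numE //; apply: le_lt_trans fD.
  by apply: le_measure; rewrite ?inE.
have [A [mA DEA HA]] : exists A : set (Rn R n), [/\ measurable A, D `\` E `<=` A &
    (@leb R n A < @leb R n (D `\` E) + (e / 2)%:E)%E].
  (* The completed measure is an infimum over countable Borel covers; [A] is the union of a nearly
     optimal one. *)
  have : (@leb R n (D `\` E) < @leb R n (D `\` E) + (e / 2)%:E)%E.
    by rewrite lteDl // lte_fin.
  move=> /ereal_inf_lt[_ [C [mC DC] <-]] HC.
  exists (\bigcup_k C k); split => //; first exact: bigcup_measurable.
  apply: le_lt_trans HC.
  rewrite /leb /completed_measure_extension measurable_mu_extE; last exact: bigcup_measurable.
  apply: measure_sigma_subadditive => //; exact: bigcup_measurable.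
have mA' := measurable_borel _ mA.
have [F [U [[mF [F' cF' FE]] [mCU _] FA AU HF]]] := borel_regular _ (measurableC mA) _ e20.
have mU : measurable U by rewrite -[U]setCK; exact: measurableC.
have KD : @vecL R n @^-1` (F' `&` X) = F `&` D by rewrite preimage_setI FE DX.
exists (F' `&` X); split.
- by rewrite setIC; apply: compact_closedI.
- by move=> x [].
- by rewrite KD; apply: measurableI.
- rewrite KD => p [Fp Dp]; apply: contrapT => nE; exact: (FA _ Fp (DEA _ (conj Dp nE))).
rewrite KD.
(* A lost point of [E] lies either in the excess of [A] or, being outside [A], in the regularity
   gap. *)
apply: (@le_lt_trans _ _ (@leb R n ((A `\` (D `\` E)) `|` ((U `\` F) `&` D)))%E).
  apply: le_measure; rewrite ?inE.
  - by apply: measurableD => //; apply: measurableI.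
  - by apply: measurableU; [exact: measurableD|apply: measurableI => //; apply: measurableD].
  - move=> p [Ep nFD]; have [Ap|nAp] := pselect (A p); first by left; split => // -[].
    right; split; last exact: ED.
    by split; [exact: AU | move=> Fp; apply: nFD; split => //; exact: ED].
rewrite (splitr e) EFinD; apply: le_lt_trans (lteD _ HF).
  apply: measureU2; first exact: measurableD.
  by apply: measurableI => //; apply: measurableD.
have AE : @leb R n A = (@leb R n (D `\` E) + @leb R n (A `\` (D `\` E)))%E.
  rewrite -measureU //; first by rewrite setDUK.
  - exact: measurableD.
  - by rewrite setDIK.
by move: HA; rewrite AE lteD2lE.
Qed.

End Lebesgue.

(** * L^1 approximation of homogeneous functions by three-layer networks *)

Section Approximation.
Context {R : realType} {n : nat} {d : measure_display} {T : measurableType d}.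
Variables (mu : {measure set T -> \bar R}) (v : T -> 'cV[R]_n) (X : set 'cV[R]_n).
Let D : set T := v @^-1` X.
Hypothesis v_surj : forall x, exists p, v p = x.
Hypothesis measurable_v : forall i, measurable_fun setT (fun p => v p i ord0).
Hypothesis cX : compact X.
Hypothesis mD : measurable D.
Hypothesis fD : (mu D < +oo)%E.
Hypothesis regular_v : forall (E : set T) (e : R), measurable E -> E `<=` D -> 0 < e ->
  exists K, [/\ compact K, K `<=` X, measurable (v @^-1` K),
    v @^-1` K `<=` E & (mu (E `\` v @^-1` K) < e%:E)%E].

Definition measurable_on (g : 'cV[R]_n -> R) := measurable_fun D (g \o v).

Definition dist1 (g h : 'cV[R]_n -> R) : \bar R :=
  (\int[mu]_(x in D) `|(g (v x) - h (v x))%:E|)%E.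

Definition approximable (g : 'cV[R]_n -> R) := measurable_on g /\
  forall e : R, 0 < e -> exists2 p, deep 3 p & (dist1 g p < e%:E)%E.

Lemma measurable_on_abs_sub g h : measurable_on g -> measurable_on h ->
  measurable_fun D (fun x => `|(g (v x) - h (v x))%:E|%E).
Proof.
move=> mg mh; apply: measurableT_comp => //; apply/measurable_EFinP.
exact: measurable_funB.
Qed.

Lemma measurable_onD g h : measurable_on g -> measurable_on h ->
  measurable_on (fun x => g x + h x).
Proof. by move=> mg mh; exact: (measurable_funD mg mh). Qed.

Lemma measurable_onM g h : measurable_on g -> measurable_on h ->
  measurable_on (fun x => g x * h x).
Proof. by move=> mg mh; exact: (measurable_funM mg mh). Qed.

Lemma measurable_on_cst c : measurable_on (fun=> c).
Proof. exact: measurable_cst. Qed.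

Lemma measurable_on_max g h : measurable_on g -> measurable_on h ->
  measurable_on (fun x => Num.max (g x) (h x)).
Proof. by move=> mg mh; exact: (measurable_maxr mg mh). Qed.

Lemma measurable_on_min g h : measurable_on g -> measurable_on h ->
  measurable_on (fun x => Num.min (g x) (h x)).
Proof. by move=> mg mh; exact: (measurable_minr mg mh). Qed.

Lemma measurable_on_sum (I : Type) (s : seq I) (F : I -> 'cV[R]_n -> R) :
  (forall i, measurable_on (F i)) -> measurable_on (fun x => \sum_(i <- s) F i x).
Proof. by move=> mF; exact: (measurable_sum s mF). Qed.

Lemma deep_measurable_on k (f : 'cV[R]_n -> R) : deep k f -> measurable_on f.
Proof.
elim => {k f} [u|k|k c f g _ mf _ mg].
- rewrite (_ : (fun x => _) = (fun x : 'cV[R]_n => \sum_j u ord0 j * x j ord0)).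
    apply: measurable_on_sum => j; apply: measurable_onM; first exact: measurable_on_cst.
    apply: measurable_funS (measurable_v j) => //.
  by apply/funext => z; rewrite mxE.
- exact: measurable_on_cst.
- apply: measurable_onD => //; apply: measurable_onM; first exact: measurable_on_cst.
  by apply: measurable_on_max => //; exact: measurable_on_cst.
Qed.

(** The pointwise hypothesis is kept general to serve both sums of approximations and passage
    through an intermediate function. *)
Lemma dist1_triangle g1 h1 g2 h2 g h :
  measurable_on g1 -> measurable_on h1 -> measurable_on g2 -> measurable_on h2 ->
  measurable_on g -> measurable_on h ->
  (forall x, X x -> `|g x - h x| <= `|g1 x - h1 x| + `|g2 x - h2 x|) ->
  (dist1 g h <= dist1 g1 h1 + dist1 g2 h2)%E.
Proof.
move=> mg1 mh1 mg2 mh2 mg mh H; rewrite /dist1 -ge0_integralD //;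
  try exact: measurable_on_abs_sub.
apply: ge0_le_integral => //; first exact: measurable_on_abs_sub.
  by apply: emeasurable_funD; exact: measurable_on_abs_sub.
by move=> x Dx; rewrite -EFinD lee_fin; exact: H.
Qed.

Lemma approximable_deep p : deep 3 p -> approximable p.
Proof.
move=> dp; split; first exact: deep_measurable_on dp.
move=> e e0; exists p => //; rewrite /dist1.
rewrite integral0_eq ?lte_fin // => x _; by rewrite subrr abse0.
Qed.

Lemma approximableD g h : approximable g -> approximable h ->
  approximable (fun x => g x + h x).
Proof.
move=> [mg Hg] [mh Hh]; split; first exact: measurable_onD.
move=> e e0; have e20 : 0 < e / 2 by rewrite divr_gt0.
have [p dp Hp] := Hg _ e20; have [q dq Hq] := Hh _ e20.
exists (fun x => p x + q x); first exact: deepD.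
rewrite (splitr e) EFinD; apply: le_lt_trans (lteD Hp Hq).
have mp := deep_measurable_on _ _ dp; have mq := deep_measurable_on _ _ dq.
apply: dist1_triangle => //; try exact: measurable_onD.
by move=> x _; rewrite opprD addrACA ler_normD.
Qed.

Lemma approximable_dist g : measurable_on g ->
  (forall e : R, 0 < e -> exists2 h, approximable h & (dist1 g h < e%:E)%E) ->
  approximable g.
Proof.
move=> mg H; split => // e e0; have e20 : 0 < e / 2 by rewrite divr_gt0.
have [h [mh /(_ _ e20)[p dp Hp]] Hh] := H _ e20.
exists p => //; rewrite (splitr e) EFinD; apply: le_lt_trans (lteD Hh Hp).
have mp := deep_measurable_on _ _ dp.
by apply: dist1_triangle => // x _; rewrite -(subrKA (h x)) ler_normD.
Qed.

Lemma dist1_le_cst g h (c : R) : measurable_on g -> measurable_on h ->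
  (forall x, X x -> `|g x - h x| <= c) -> (dist1 g h <= c%:E * mu D)%E.
Proof.
move=> mg mh H; rewrite -integral_cst //.
apply: ge0_le_integral => //; first exact: measurable_on_abs_sub.
by move=> x Dx; rewrite lee_fin; exact: H.
Qed.

Lemma approximableZ c g : approximable g -> approximable (fun x => c * g x).
Proof.
move=> [mg Hg]; split; first by apply: measurable_onM => //; exact: measurable_on_cst.
(* Adding 1 allows the division when [c = 0]. *)
move=> e e0; have c0 : 0 < `|c| + 1 by rewrite ltr_wpDl.
have [p dp Hp] := Hg _ (divr_gt0 e0 c0).
exists (fun x => c * p x); first exact: deepZ.
have mp := deep_measurable_on _ _ dp.
have -> : dist1 (fun x => c * g x) (fun x => c * p x) = (`|c|%:E * dist1 g p)%E.
  rewrite /dist1 -ge0_integralZl //; last exact: measurable_on_abs_sub.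
  by apply: eq_integral => x _; rewrite -mulrBr -EFinM -normrM.
have d0 : (0 <= dist1 g p)%E by exact: integral_ge0.
move: Hp d0; case: (dist1 g p) => [r| |] //; rewrite -EFinM !lte_fin lee_fin => Hr r0.
apply: (@le_lt_trans _ _ ((`|c| + 1) * r)); first by rewrite ler_wpM2r // lerDl.
by rewrite mulrC -ltr_pdivlMr.
Qed.

Lemma norm1_bound : exists2 B : R, 0 <= B & forall x, X x -> norm1 x <= B.
Proof.
have c1 : continuous (fun _ : 'cV[R]_n => 1 : R) by move=> x; exact: cst_continuous.
have [B B0 HB] := compact_dominated X norm1 _ cX
  (deep_continuous _ _ deep_norm1) c1 (fun _ _ => ltr01).
by exists B => // x /HB; rewrite mulr1.
Qed.


Lemma measurable_on_ge0 g : measurable_on g -> measurable (D `&` [set p | 0 <= g (v p)]).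
Proof.
move=> mg; rewrite (_ : [set p | _] = (g \o v) @^-1` `[0, +oo[).
  by apply: mg => //; exact: measurable_itv.
by apply/seteqP; split => p; rewrite /= in_itv /= andbT.
Qed.

Lemma measurable_on_gt0 g : measurable_on g -> measurable (D `&` [set p | 0 < g (v p)]).
Proof.
move=> mg; rewrite (_ : [set p | _] = (g \o v) @^-1` `]0, +oo[).
  by apply: mg => //; exact: measurable_itv.
by apply/seteqP; split => p; rewrite /= in_itv /= andbT.
Qed.

Lemma measurable_on_indic (C : set 'cV[R]_n) : measurable (D `&` v @^-1` C) -> measurable_on \1_C.
Proof.
move=> mC; rewrite /measurable_on.
apply: (eq_measurable_fun (\1_(D `&` v @^-1` C) : T -> R)).
  by move=> p /set_mem Dp; rewrite /= !indicE in_setI (mem_set Dp).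
exact: measurable_indic.
Qed.

(** Compact sets [K] inside and [L] outside the cone feed the Urysohn lemma. The resulting network
    is exact on both, and elsewhere the error is at most [B] on a set [W] of measure below
    [e / (B + 1)]. *)
Lemma approximable_cone (C : set 'cV[R]_n) :
  (forall x lam, 0 < lam -> C x -> C (lam *: x)) ->
  measurable (D `&` v @^-1` C) -> approximable (fun x => norm1 x * \1_C x).
Proof.
move=> HC mC.
have mN : measurable_on norm1 by exact: deep_measurable_on deep_norm1.
have mD0 := measurable_on_gt0 _ mN.
(* The origin is removed because the Urysohn lemma requires both compact sets to avoid it. *)
pose D0 := D `&` [set p | 0 < norm1 (v p)].
pose E := D0 `&` (D `&` v @^-1` C); pose E' := D0 `\` (D `&` v @^-1` C).
have mE : measurable E by exact: measurableI.
have mE' : measurable E' by exact: measurableD.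
have nz x : 0 < norm1 x -> x <> 0 by move=> + x0; rewrite x0 norm10 ltxx.
split; first by apply: measurable_onM => //; exact: measurable_on_indic.
move=> e e0; have [B B0 HB] := norm1_bound.
have B1 : 0 < B + 1 by rewrite ltr_wpDl.
have eta0 : 0 < e / (B + 1) / 2 by rewrite !divr_gt0.
have [K [cK KX mK KE HK]] := regular_v E _ mE (fun p H => H.2.1) eta0.
have [L [cL LX mL LE HL]] := regular_v E' _ mE' (fun p H => H.1.1) eta0.
have KP x : K x -> x <> 0 /\ C x.
  by have [p <-] := v_surj x; move=> /KE[[_ /nz p0] [_ Cp]].
have LP x : L x -> x <> 0 /\ ~ C x.
  by have [p <-] := v_surj x; move=> /LE[[Dp /nz p0] nC]; split => // Cp; apply: nC.
have [||x lam /KP[_ Cx] lam0 /LP[_]|q [dq q01 qK qL]] := deep_urysohn K L cK cL.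
- by move=> /KP[].
- by move=> /LP[].
- by move=> nC; apply: nC; exact: HC.
exists q => //.
pose W := (E `\` v @^-1` K) `|` (E' `\` v @^-1` L).
have mW : measurable W by apply: measurableU; exact: measurableD.
have WD : W `<=` D by move=> p [[[[]]]|[[[]]]].
have HW : (mu W < (e / (B + 1))%:E)%E.
  rewrite (splitr (e / (B + 1))) EFinD; apply: le_lt_trans (lteD HK HL).
  by apply: measureU2; exact: measurableD.
apply: (@le_lt_trans _ _ (\int[mu]_(p in D) (B * \1_W p)%:E)%E).
  apply: ge0_le_integral => //.
  - apply: (measurable_on_abs_sub (fun x => norm1 x * \1_C x) q);
    last exact: deep_measurable_on dq.
    by apply: measurable_onM => //; exact: measurable_on_indic.
  - apply/measurable_EFinP; apply: measurable_funM; first exact: measurable_cst.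
    exact: measurable_indic.
  move=> p Dp; rewrite lee_fin.
  have N0 := norm1_ge0 (v p); have NB := HB _ Dp; have /andP[q0 qN] := q01 (v p).
  (* At the origin both functions vanish, since [q] is squeezed between 0 and [norm1]. *)
  have [p0|p0] := ltP 0 (norm1 (v p)); last first.
    have NE : norm1 (v p) = 0 by apply/eqP; rewrite eq_le p0.
    have -> : q (v p) = 0 by apply/eqP; rewrite eq_le q0 andbT -NE.
    by rewrite NE mul0r subrr normr0 mulr_ge0 // indicE.
  have bound : `|norm1 (v p) * \1_C (v p) - q (v p)| <= B.
    rewrite indicE; case: (_ \in _); rewrite ?mulr1 ?mulr0 ?sub0r ?normrN ger0_norm //; lra.
  have [Wp|nWp] := pselect (W p); first by rewrite [\1_W p]indicE mem_set ?mulr1.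
  rewrite [\1_W p]indicE memNset // mulr0 indicE.
  have [Cp|nCp] := pselect (C (v p)).
    rewrite mem_set // qK ?mulr1 ?subrr ?normr0 //.
    by apply: contrapT => nK; apply: nWp; left.
  rewrite memNset // qL ?mulr0 ?subrr ?normr0 //.
  by apply: contrapT => nL; apply: nWp; right; split => //; split => // -[].
under eq_integral do rewrite EFinM.
rewrite ge0_integralZl //; last by apply/measurable_EFinP; exact: measurable_indic.
rewrite integral_indic // (setIidl WD).
have W0 : 0 <= fine (mu W) by exact: fine_ge0.
have WE : mu W = (fine (mu W))%:E.
  by rewrite fineK // ge0_fin_numE // (lt_trans HW) ?ltry.
move: (fine (mu W)) WE W0 => r WE W0.
move: HW; rewrite WE -EFinM !lte_fin => Hr.
apply: (@le_lt_trans _ _ ((B + 1) * r)); first by rewrite ler_wpM2r // lerDl.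
by rewrite mulrC -ltr_pdivlMr.
Qed.

(** For positive [u] the sum counts the multiples of [u] up to [s], so it is [s] rounded down to
    such a multiple. *)
Lemma layer_cake (u s : R) (N : nat) : 0 <= u -> 0 <= s <= N%:R * u ->
  `|s - \sum_(i < N) u * (i.+1%:R * u <= s)%R%:R| <= u.
Proof.
move=> u0 /andP[s0]; elim: N => [|N IH] sN.
  have -> : s = 0 by apply/eqP; rewrite eq_le s0 andbT; rewrite mul0r in sN.
  by rewrite big_ord0 subrr normr0.
rewrite big_ord_recr /=; have [sN'|sN'] := leP s (N%:R * u).
  (* With [s] at most [N * u], the top level is reached only when [u = 0]. *)
  have -> : u * (N.+1%:R * u <= s)%R%:R = 0.
    case: leP => H; rewrite ?mulr0 // mulr1.
    by move: H; rewrite -natr1 mulrDl mul1r; lra.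
  by rewrite addr0; exact: IH.
rewrite (eq_bigr (fun=> u)) => [|i _]; last first.
  rewrite (_ : (_ <= s)%R = true) ?mulr1 //; apply: le_trans (ltW sN').
  by rewrite ler_wpM2r // ler_nat.
rewrite sumr_const card_ord -mulr_natl; move: sN sN'.
rewrite -natr1 mulrDl mul1r => sN sN'.
by case: (leP (N%:R * u + u) s) => H; rewrite ?mulr1 ?mulr0 ler_norml; apply/andP; split; lra.
Qed.

(** The shifted function [g + c * norm1] lies between 0 and [2 * c * norm1]. It is cut into [N.+1]
    layers of height [del * norm1]; as this height is itself homogeneous, the superlevel sets [C i]
    are cones. *)
Lemma approximable_bounded g (c : R) : 0 <= c -> positive_homogeneous g -> measurable_on g ->
  (forall x, X x -> `|g x| <= c * norm1 x) -> approximable g.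
Proof.
move=> c0 hg mg gc; apply: approximable_dist => // e e0.
have [B B0 HB] := norm1_bound.
have mN : measurable_on norm1 by exact: deep_measurable_on deep_norm1.
have w0 : 0 <= fine (mu D) by exact: fine_ge0.
have wE : mu D = (fine (mu D))%:E by rewrite fineK // ge0_fin_numE.
move: (fine (mu D)) w0 wE => w w0 wE.
(* This makes the final error bound [del * B * w] smaller than [e]. *)
have [N HN] : exists N : nat, 2 * c * B * w / e < N.+1%:R.
  exists (Num.bound (2 * c * B * w / e)).
  have := archi_boundP (_ : 0 <= 2 * c * B * w / e).
  rewrite !mulr_ge0 // ?invr_ge0 ?(ltW e0) // => /(_ isT) H.
  by apply: (lt_trans H); rewrite ltr_nat.
pose del := 2 * c / N.+1%:R.
have del0 : 0 <= del by rewrite divr_ge0 // mulr_ge0.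
pose C (i : nat) := [set x : 'cV[R]_n | i.+1%:R * (del * norm1 x) <= g x + c * norm1 x].
have mC i : measurable (D `&` v @^-1` C i).
  rewrite (_ : v @^-1` C i = [set p | 0 <= g (v p) + (c - i.+1%:R * del) * norm1 (v p)]).
    apply: (measurable_on_ge0 (fun x => g x + (c - i.+1%:R * del) * norm1 x)).
    apply: measurable_onD => //; apply: measurable_onM => //; exact: measurable_on_cst.
  by apply/seteqP; split => p; rewrite /C /=; lra.
have aC i : approximable (fun x => norm1 x * \1_(C i) x).
  apply: approximable_cone => // x lam lam0; rewrite /C /= norm1Z hg // gtr0_norm //.
  move=> H; rewrite (_ : _ * _ = lam * (i.+1%:R * (del * norm1 x))); last by ring.
  rewrite (_ : _ + _ = lam * (g x + c * norm1 x)); last by ring.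
  by rewrite ler_pM2l.
pose h x := - c * norm1 x + \sum_(i < N.+1) del * (norm1 x * \1_(C i) x).
have ah : approximable h.
  apply: approximableD.
    by apply: approximableZ; apply: approximable_deep; do 2!apply: deepS; exact: deep_norm1.
  rewrite /= (_ : (fun x => _) =
    (fun x => \sum_(i <- index_enum 'I_N.+1) del * (norm1 x * \1_(C i) x))) //.
  elim: (index_enum _) => [|i r IH].
    rewrite (_ : (fun x => _) = (fun=> 0)); first exact/approximable_deep/deep_zero.
    by apply/funext => x; rewrite big_nil.
  rewrite (_ : (fun x => _) = (fun x => del * (norm1 x * \1_(C i) x) +
      \sum_(j <- r) del * (norm1 x * \1_(C j) x))).
    by apply: approximableD => //; apply: approximableZ.
  by apply/funext => x; rewrite big_cons.
exists h => //; apply: (@le_lt_trans _ _ ((del * B)%:E * mu D)%E).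
  apply: dist1_le_cst => //; first by case: ah.
  move=> x Xx; apply: (@le_trans _ _ (del * norm1 x)); last by rewrite ler_wpM2l // HB.
  have N0 := norm1_ge0 x.
  have := layer_cake (del * norm1 x) (g x + c * norm1 x) N.+1.
  rewrite mulr_ge0 // => /(_ isT).
  have -> : 0 <= g x + c * norm1 x <= N.+1%:R * (del * norm1 x).
    have -> : N.+1%:R * (del * norm1 x) = 2 * c * norm1 x.
      by rewrite /del mulrA; congr (_ * _); rewrite mulrC divfK // pnatr_eq0.
    have := gc _ Xx; rewrite ler_norml => /andP[]; move: (c * norm1 x) (mulrA 2 c (norm1 x)) => t <- *.
    by apply/andP; split; lra.
  move=> /(_ isT); apply: le_trans; rewrite le_eqVlt; apply/orP; left; apply/eqP; congr `|_|.
  rewrite /h opprD mulNr opprK addrA; congr (_ - _).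
  apply: eq_bigr => i _; rewrite mulrA indicE; congr (_ * (nat_of_bool _)%:R).
  by apply/idP/idP => [/set_mem|] //= H; apply/mem_set.
rewrite wE -EFinM lte_fin.
have -> : del * B * w = 2 * c * B * w / N.+1%:R by rewrite /del; ring.
by rewrite ltr_pdivrMr ?ltr0n // [ltRHS]mulrC -ltr_pdivrMr.
Qed.

(** The truncations [F k] of [f] between [- k * norm1] and [k * norm1] stay homogeneous and fall
    under the bounded case. Dominated convergence with majorant [|f|] brings them to [f] in L^1. *)
Lemma approximable_homogeneous f : positive_homogeneous f ->
  mu.-integrable D (EFin \o f \o v) -> approximable f.
Proof.
move=> hf If.
have mf : measurable_on f by apply/measurable_EFinP; exact: measurable_int If.
have mN : measurable_on norm1 by exact: deep_measurable_on deep_norm1.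
have f0 : f 0 = 0.
  have := hf 0 2 (ltr0n _ 2); rewrite scaler0; lra.
pose F (k : nat) x := Num.max (- k%:R * norm1 x) (Num.min (f x) (k%:R * norm1 x)).
have mF k : measurable_on (F k).
  apply: measurable_on_max; first by apply: measurable_onM => //; exact: measurable_on_cst.
  by apply: measurable_on_min => //; apply: measurable_onM => //; exact: measurable_on_cst.
have kN0 k (x : 'cV[R]_n) : 0 <= k%:R * norm1 x :> R by rewrite mulr_ge0 ?norm1_ge0.
have aF k : approximable (F k).
  apply: (approximable_bounded _ k%:R) => //.
    move=> x lam lam0; rewrite /F norm1Z gtr0_norm // hf //.
    by rewrite maxr_pMr ?minr_pMr ?(ltW lam0) //; congr Num.max; [ring|congr Num.min; ring].
  move=> x _; rewrite /F ler_norml; have := kN0 k x; rewrite mulNr.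
  move: (k%:R * norm1 x) => t t0.
  by case: (leP (f x) t) => ?;
    [case: (leP (- t) (f x)) => ?|case: (leP (- t) t) => ?]; apply/andP; split; lra.
apply: approximable_dist => // e e0.
have [|||||_ _ cvgF] := @dominated_convergence _ _ _ mu D mD
  (fun k p => `|(f (v p) - F k (v p))%:E|%E) (cst 0%E) (fun p => `|(EFin \o f \o v) p|%E).
- by move=> k; exact: measurable_on_abs_sub.
- exact: measurable_cst.
(* At each point the error is eventually zero: at the origin because [f 0 = 0], elsewhere once [k]
   exceeds [|f| / norm1]. *)
- apply: aeW => p Dp; apply: cvg_near_cst.
  have [K HK] : exists K : nat, `|f (v p)| <= K%:R * norm1 (v p).
    have [x0|/eqP x0] := eqVneq (v p) 0.
      by exists 0%N; rewrite x0 f0 normr0 mul0r.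
    have N0 := norm1_gt0 _ x0.
    exists (Num.bound (`|f (v p)| / norm1 (v p))).
    rewrite -ler_pdivrMr //; apply/ltW/archi_boundP.
    by rewrite divr_ge0 // norm1_ge0.
  exists K => // k /= Kk.
  have : `|f (v p)| <= k%:R * norm1 (v p).
    by apply: le_trans HK _; rewrite ler_wpM2r ?norm1_ge0 // ler_nat.
  rewrite ler_norml => /andP[H1 H2].
  have -> : F k (v p) = f (v p) by rewrite /F (min_l H2) max_r // mulNr.
  by rewrite /= subrr normr0.
- exact: integrable_abse.
(* Truncation moves the value towards 0 without crossing it, so it changes [f] by at most [|f|]. *)
- apply: aeW => p k Dp; rewrite abse_id lee_fin /F mulNr.
  have := kN0 k (v p); move: (k%:R * norm1 (v p)) => t t0.
  rewrite ler_norml.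
  move: (f (v p)) => s.
  by case: (leP s t) => ?; [case: (leP (- t) s) => ?|case: (leP (- t) t) => ?];
    case: (ger0P s) => ?; apply/andP; split; lra.
rewrite integral0 in cvgF.
have e0' : (0 < e%:E)%E by rewrite lte_fin.
have [k _ /(_ k (leqnn k)) Hk] := cvgF _ (open_ereal_lt' e0').
by exists (F k).
Qed.

End Approximation.

(** * Approximation for Lebesgue measure, followed by narrowing of the network *)

Theorem theorem2 (R : realType) (n : nat) (X : set 'cV[R]_n) (f : 'cV[R]_n -> R) :
  measurable (@vecL R n @^-1` X) ->
  compact X ->
  positive_homogeneous f ->
  (@leb R n).-integrable (@vecL R n @^-1` X) (EFin \o f \o @vecL R n) ->
  forall eps : R, 0 < eps ->
  exists A : homoMLP R n,
    (mlp_width A <= 2 * (n + 4))%N /\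
    (\int[@leb R n]_(x in @vecL R n @^-1` X)
        `|(f (vecL x) - mlp_eval A (vecL x))%:E| < eps%:E)%E.
Proof.
move=> mX cX hf If eps eps0.
have fX := leb_finite X mX cX.
have reg E e := inner_compact _ mX fX X E e (erefl _) cX.
have [_ /(_ _ eps0)[p dp Hp]] :=
  approximable_homogeneous _ (@vecL R n) X (@vec_surj R n) measurable_vecL
    cX mX fX reg f hf If.
have [A [wA EA]] := deep3_narrow p dp.
by exists A; split => //; rewrite EA; exact: Hp.
Qed.
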